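(* Let $X$ be a smooth complete toric variety with fan $\Sigma$ and $\mathrm{Cl}(X)$-graded Cox ring $R=\mathbb{C}[x_1,\dots,x_r]$. Let $I\subset R$ be a monomial ideal with Klyachko diagram $\{(\mathcal{C}^\sigma_I,\Delta^\sigma_I)\}_{\sigma\in\Sigma}$. Then the Hilbert polynomial $P_{R/I}$ of $I$ is constant if and only if $s_\rho=0$ for any $\rho\in\Sigma(1)$ and $\Delta^\sigma_I$ is finite for any $\sigma\in\Sigma_{\max}$. Moreover, $$P_{R/I}(\alpha)=\sum_{\sigma\in\Sigma_{\max}}|\Delta^\sigma_I| .$$
   Context: Setting. $X$ is an $n$-dimensional smooth complete toric variety over $\mathbb{C}$ with fan $\Sigma\subset N\otimes\mathbb{R}$, $N\cong\mathbb{Z}^n$, $M=\mathrm{Hom}(N,\mathbb{Z})$; $\Sigma_{\max}$ is the set of maximal cones. $\Sigma(1)=\{\rho_1,\dots,\rho_r\}$ is the ordered set of rays, $n(\rho)\in N$ is the first nonzero lattice point on $\rho$, and $\langle m,\rho\rangle:=\langle m,n(\rho)\rangle$ for $m\in M$. The Cox ring $R=\mathbb{C}[x_1,\dots,x_r]$ has one variable $x_i=x_{\rho_i}$ per ray and is graded by the class group $\mathrm{Cl}(X)\cong\mathbb{Z}^\ell$ via $\deg x_i=[D_{\rho_i}]$, where $D_{\rho_i}$ is the torus-invariant divisor corresponding to $\rho_i$. The Hilbert function is $h_{R/I}(\alpha)=\dim_{\mathbb{C}}(R/I)_\alpha$ for $\alpha\in\mathrm{Cl}(X)$, and the Hilbert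 polynomial $P_{R/I}$ is the polynomial in $\alpha$ with $P_{R/I}(\alpha)=h_{R/I}(\alpha)$ for $\alpha\gg0$. Klyachko diagram. Let $I=(m_1,\dots,m_t)$ be generated by monomials $m_i$; $\deg_{\rho_j}$ of a monomial is its exponent in $x_j$. Put $s_j=s_{\rho_j}:=\min_i\deg_{\rho_j}(m_i)$. For $\sigma=\mathrm{cone}(\rho_{i_1},\dots,\rho_{i_c})\in\Sigma$ of dimension $c$, put $\mathcal{C}^\sigma_I:=\{m\in M\mid\langle m,\rho_{i_p}\rangle\ge s_{i_p},\ 1\le p\le c\}$. For a subset $\mathcal{S}=\{n_1,\dots,n_s\}\subset\{m_1,\dots,m_t\}$ define $\Delta^\sigma_I(\mathcal{S})\subset\mathcal{C}^\sigma_I$ recursively: - $\Delta^\sigma_I(\emptyset):=\mathcal{C}^\sigma_I$. - If $s\ge1$ and $c=0$ (i.e. $\sigma=\{0\}$): $\Delta^\sigma_I(\mathcal{S}):=\emptyset$. - If $s\ge1$ and $c\geq 1$, order the elements so that $\deg_{\rho_{i_c}}(n_{1})\le\cdots\le\deg_{\rho_{i_c}}(n_{s})$. If $c=1$: $\Delta^\sigma_I(\mathcal{S}):=\{m\in M\mid s_{i_1}\le\langle m,\rho_{i_1}\rangle<\deg_{\rho_{i_1}}(n_1)\}$. If $c\ge2$, put $\sigma'=\mathrm{cone}(\rho_{i_1},\dots,\rho_{i_{c-1}})$ and $\Delta^\sigma_I(\mathcal{S}):=\bigcup_{j=0}^s\Delta^\sigma_I(\mathcal{S})_j$, where $\Delta^\sigma_I(\mathcal{S})_0:=\{m\in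 M\mid s_{i_c}\le\langle m,\rho_{i_c}\rangle<\deg_{\rho_{i_c}}(n_1)\}\cap\Delta^{\sigma'}_I(\emptyset)$, $\Delta^\sigma_I(\mathcal{S})_j:=\{m\in M\mid\deg_{\rho_{i_c}}(n_j)\le\langle m,\rho_{i_c}\rangle<\deg_{\rho_{i_c}}(n_{j+1})\}\cap\Delta^{\sigma'}_I(\{n_1,\dots,n_j\})$ for $1\le j\le s-1$, $\Delta^\sigma_I(\mathcal{S})_s:=\{m\in M\mid\deg_{\rho_{i_c}}(n_s)\le\langle m,\rho_{i_c}\rangle\}\cap\Delta^{\sigma'}_I(\{n_1,\dots,n_s\})$. Finally $\Delta^\sigma_I:=\Delta^\sigma_I(\{m_1,\dots,m_t\})$. The collection $\{(\mathcal{C}^\sigma_I,\Delta^\sigma_I)\}_{\sigma\in\Sigma}$ is the Klyachko diagram of $I$.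
   Formalization: The equivalence is stated for dimension n ≠ 1, as it fails for P^1 with I=(x_0) (P=1 but s=1); the formula, under the finiteness condition, holds for all n. P must be the unique polynomial agreeing with h for α≫0, so non-projective X, where it is not determined, is excluded. *)

(* Defs.v *)
From HB Require Import structures.
From mathcomp Require Import all_boot all_order all_algebra.
From mathcomp Require Import finmap.
From mathcomp Require Import boolp classical_sets cardinality reals.
From mathcomp Require Import complex mpoly.

Set Implicit Arguments.
Unset Strict Implicit.
Unset Printing Implicit Defensive.

Import Order.TTheory GRing.Theory Num.Theory.

Local Open Scope classical_set_scope.
Local Open Scope ring_scope.

(* N = Z^n is 'rV[int]_n, its dual M = Hom(N, Z) is 'cV[int]_n, and the
   evaluation pairing is the matrix product. *)
Definition pairing (n : nat) (m : 'cV[int]_n) (u : 'rV[int]_n) : int :=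
  (u *m m) 0 0.

Section Fans.
Variables (RR : realType) (n r : nat).

(* The cone in N (x) RR generated by the lattice vectors u_i, i \in s. *)
Definition cone (u : 'I_r -> 'rV[int]_n) (s : {set 'I_r}) : set 'rV[RR]_n :=
  [set v | exists c : 'I_r -> RR,
     (forall i, 0 <= c i) /\ v = \sum_(i in s) c i *: map_mx intr (u i)].

Definition is_face (C' C : set 'rV[RR]_n) : Prop :=
  exists w : 'cV[RR]_n, (forall v, C v -> 0 <= (v *m w) 0 0) /\
    C' = [set v | C v /\ (v *m w) 0 0 = 0].

(* Smooth complete fans.  A cone is given by the set of indices of the rays
   that generate it; by [fan_smooth] the generators are the primitive lattice
   points n(rho) of the rays and the cones are strongly convex, rational and
   simplicial, of dimension equal to the number of their rays. *)
Record smooth_complete_fan : Type := SmoothCompleteFan {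
  ray : 'I_r -> 'rV[int]_n;
  cones : {set {set 'I_r}};
  ray_inj : injective ray;
  ray_cone : forall i, [set i]%SET \in cones;
  fan_faces : forall s, s \in cones -> forall C', is_face C' (cone ray s) ->
    exists2 t, t \in cones & C' = cone ray t;
  fan_inter : forall s t, s \in cones -> t \in cones ->
    is_face (cone ray s `&` cone ray t) (cone ray s);
  fan_smooth : forall s, s \in cones ->
    exists2 B : 'M[int]_n, B \in unitmx & forall i, i \in s ->
      exists k, ray i = row k B;
  fan_complete : forall v : 'rV[RR]_n, exists2 s, s \in cones & cone ray s v
}.

Definition max_cones (F : smooth_complete_fan) : {set {set 'I_r}} :=
  [set s | maxset (fun t => t \in cones F) s]%SET.

End Fans.

Section ClassGroup.
Variables (RR : realType) (n r : nat) (F : smooth_complete_fan RR n r).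

(* Torus-invariant divisors \sum_i a_i D_i are vectors a : 'rV[int]_r;
   Cl(X) is their quotient by the divisors of the characters of the torus. *)
Definition div_char (m : 'cV[int]_n) : 'rV[int]_r :=
  \row_i pairing m (ray F i).

Definition principal : {pred 'rV[int]_r} :=
  fun D => `[< exists m, D = div_char m >].

Lemma div_charB (m1 m2 : 'cV[int]_n) :
  div_char (m1 - m2) = div_char m1 - div_char m2.
Proof. by apply/rowP => i; rewrite !mxE /pairing mulmxBr !mxE. Qed.

Lemma principal_zmod_closed : zmod_closed principal.
Proof.
split=> [|x y /asboolP [m1 ->] /asboolP [m2 ->]]; apply/asboolP.
  by exists 0; apply/rowP => i; rewrite !mxE /pairing mulmx0 mxE.
by exists (m1 - m2); rewrite div_charB.
Qed.

HB.instance Definition _ :=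
  GRing.isZmodClosed.Build 'rV[int]_r principal principal_zmod_closed.

Definition Cl : zmodType := Quotient.quot principal.

Definition cl (D : 'rV[int]_r) : Cl := (\pi_(Quotient.quot principal) D)%qT.

Definition deg (a : 'X_{1..r}) : Cl := cl (\row_i (a i)%:Z).

Definition cox_component (alpha : Cl) : set {mpoly RR[i][r]} :=
  [set f | forall a, a \in msupp f -> deg a = alpha].

(* alpha is nef, i.e. O(alpha) is globally generated: at every torus-fixed
   point some monomial section of O(alpha) does not vanish. *)
Definition nef (alpha : Cl) : Prop :=
  forall s, s \in max_cones F ->
    exists a : 'X_{1..r}, deg a = alpha /\ forall i, i \in s -> a i = 0%N.

(* "Q alpha for alpha >> 0". *)
Definition for_large (Q : Cl -> Prop) : Prop :=
  exists alpha0, forall alpha, nef (alpha - alpha0) -> Q alpha.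

End ClassGroup.

(* dim (U / (U \cap W)) = d: the classes of some b_0, ..., b_(d-1) in U form a
   basis of the quotient. *)
Definition quotient_dim (K : fieldType) (V : lmodType K) (U W : set V)
    (d : nat) : Prop :=
  exists b : 'I_d -> V, (forall i, U (b i)) /\
    forall v, U v -> exists! c : 'rV[K]_d, W (v - \sum_i c 0 i *: b i).

Section MonomialIdeals.
Variables (RR : realType) (n r : nat) (F : smooth_complete_fan RR n r).
Variable gens : seq 'X_{1..r}.

Definition monomial_ideal : set {mpoly RR[i][r]} :=
  [set f | exists q : 'I_(size gens) -> {mpoly RR[i][r]},
     f = \sum_k q k * 'X_[tnth (in_tuple gens) k]].

(* h_(R/I)(alpha) = d; since I is homogeneous, the component of degree alpha of
   R/I is R_alpha / (R_alpha \cap I). *)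
Definition hilbert_function (alpha : Cl F) (d : nat) : Prop :=
  quotient_dim (cox_component alpha) monomial_ideal d.

(* A polynomial in alpha is a polynomial in the coordinates of alpha under an
   isomorphism phi : Cl(X) -> Z^l. *)
Definition eval_class (l : nat) (phi : Cl F -> 'rV[int]_l) (P : {mpoly rat[l]})
    (alpha : Cl F) : rat :=
  P.@[fun k => (phi alpha 0 k)%:~R].

(* "The" polynomial agreeing with the Hilbert function for alpha >> 0: it is
   required to be the only one.  (If X is not projective, the nef classes do not
   span Cl(X) (x) QQ, and there is no such P.) *)
Definition is_hilbert_polynomial (l : nat) (phi : Cl F -> 'rV[int]_l)
    (P : {mpoly rat[l]}) : Prop :=
  unique (fun P' => for_large (fun alpha : Cl F =>
    exists2 d, hilbert_function alpha d & eval_class phi P' alpha = d%:R)) P.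

(* s_j = min_i deg_j(m_i), with the convention s_j = 0 when there is no
   generator (zero ideal). *)
Definition min_deg (j : 'I_r) : nat :=
  \big[minn/(head 0%MM gens) j]_(a <- gens) a j.

(* In the next three definitions, cs lists the rays of a cone sigma with the
   last one (i_c) at its head, so that its tail lists the rays of sigma'. *)
Definition klyachko_C (cs : seq 'I_r) : set 'cV[int]_n :=
  [set m | forall i, i \in cs -> (min_deg i)%:Z <= pairing m (ray F i)].

(* The j-th slab between consecutive degrees of T = [n_1, ..., n_s] along the
   ray i: [s_i, deg n_1) for j = 0, [deg n_j, deg n_(j+1)) for 0 < j < s and
   [deg n_s, +oo) for j = s > 0. *)
Definition slab (i : 'I_r) (T : seq 'X_{1..r}) (j : nat) : set 'cV[int]_n :=
  [set m |
    (if j is j'.+1 then (nth 0%MM T j' i)%:Z else (min_deg i)%:Z)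
      <= pairing m (ray F i) /\
    ((j < size T)%N -> pairing m (ray F i) < (nth 0%MM T j i)%:Z)].

Fixpoint klyachko_Delta_rec (cs : seq 'I_r) (S : seq 'X_{1..r}) :
    set 'cV[int]_n :=
  if S is [::] then klyachko_C cs else
  match cs with
  | [::] => set0
  | i :: cs' =>
      let T := sort (fun a b : 'X_{1..r} => (a i <= b i)%N) S in
      if cs' is [::] then slab i T 0 else
      \bigcup_(j in `I_(size T).+1)
        (slab i T j `&` klyachko_Delta_rec cs' (take j T))
  end.

(* The rays of a cone are ordered by their index. *)
Definition klyachko_Delta (s : {set 'I_r}) : set 'cV[int]_n :=
  klyachko_Delta_rec (rev (enum s)) gens.

End MonomialIdeals.

(* Main.v *)
Require Import Defs.
From HB Require Import structures.
From mathcomp Require Import all_boot all_order all_algebra.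
From mathcomp Require Import finmap.
From mathcomp Require Import boolp classical_sets cardinality reals.
From mathcomp Require Import complex mpoly.
From mathcomp Require Import zify ring.

(** Write I for the monomial ideal generated by [gens], sigma for a maximal
    cone.

    A monomial of degree alpha outside I is a lattice point, and its
    exponents along the rays of sigma are the coordinates of that point in
    the chart of sigma. Membership in Delta^sigma says exactly that this
    local monomial is divisible by the product of the x_i^(s_i) but by no
    localized generator ([klyachko_DeltaP]). When all s_rho vanish,
    Delta^sigma is therefore the staircase of the ideal that I induces on
    the affine chart U_sigma = A^n, and it is finite iff I contains, locally
    at sigma, a pure power of every coordinate. This last condition, over
    all sigma, is [finite_support]: I vanishes at most at the torus fixed
    points of X.

    Finite case. For alpha large, every standard monomial a of degree alpha
    belongs to exactly one Delta^sigma. Let d exceed all exponents of the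
    generators and let T be the set of rays i with a_i < d. By completeness,
    the sum of the primitive vectors of the rays in T is a nonnegative
    combination of the rays of some sigma; pairing this relation with the
    lattice point of a bounds by r * d the sum of the lattice distances from
    the vertex sigma of the polytope of alpha to the facets of the rays in
    T. Once all nonzero such distances are larger than that, T lies in sigma
    ([small_rays_in_cone]). Conversely a point of Delta^sigma has all its
    sigma-coordinates below d, so T = sigma for it, which gives
    disjointness, and for alpha large it extends to an honest monomial.
    Hence the Hilbert function is eventually the constant sum of the
    |Delta^sigma| ([hilbert_function_Delta]), and so is the polynomial, by
    uniqueness.

    Infinite case. If [finite_support] fails at the ray i of sigma, then the
    whole edge of the polytope of alpha that leaves the vertex sigma in
    direction i consists of standard monomials; these edges are arbitrarily
    long ([many_standard]), so the Hilbert function is not eventually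
    constant. For n <> 1 every ray has a neighbour in a maximal cone, whence
    [finite_support] also forces all s_rho to vanish.

    Both cases need a class whose coordinates at all vertices are positive
    off the vertex, that is, an ample class. It is extracted from the
    uniqueness of the Hilbert polynomial: a coordinate that vanished on all
    nef classes would be a nonzero linear form that could be added to the
    polynomial without changing its values on a translate of the nef cone
    ([hilbert_polynomial_ample]). *)

Set Implicit Arguments.
Unset Strict Implicit.
Unset Printing Implicit Defensive.

Import Order.TTheory GRing.Theory Num.Theory.

Local Open Scope classical_set_scope.
Local Open Scope ring_scope.

(** * The geometry of a smooth complete fan, in terms of lattice points *)

Section Pairing.
Variable n : nat.
Implicit Types (m : 'cV[int]_n) (u : 'rV[int]_n).

Lemma pairingDr m u v : pairing m (u + v) = pairing m u + pairing m v.
Proof. by rewrite /pairing mulmxDl mxE. Qed.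

Lemma pairingZr m a u : pairing m (a *: u) = a * pairing m u.
Proof. by rewrite /pairing -scalemxAl mxE. Qed.

Lemma pairing_sumr (I : finType) (P : pred I) m (f : I -> 'rV[int]_n) :
  pairing m (\sum_(i | P i) f i) = \sum_(i | P i) pairing m (f i).
Proof. by rewrite /pairing mulmx_suml summxE. Qed.

Lemma pairingZl a m u : pairing (a *: m) u = a * pairing m u.
Proof. by rewrite /pairing -scalemxAr mxE. Qed.

Lemma pairing_suml (I : finType) (P : pred I) (f : I -> 'cV[int]_n) u :
  pairing (\sum_(i | P i) f i) u = \sum_(i | P i) pairing (f i) u.
Proof. by rewrite /pairing mulmx_sumr summxE. Qed.

Lemma pairing_col (A : 'M[int]_n) k u : pairing (col k A) u = (u *m A) 0 k.
Proof. by rewrite /pairing colE mulmxA -colE mxE. Qed.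

Lemma pairing_delta m k : pairing m (delta_mx 0 k) = m k 0.
Proof. by rewrite /pairing -rowE mxE. Qed.

Lemma pairing_inj m1 m2 : (forall u, pairing m1 u = pairing m2 u) -> m1 = m2.
Proof. by move=> eq12; apply/colP => k; rewrite -!pairing_delta. Qed.

End Pairing.

Section FanGeometry.
Variables (RR : realType) (n r : nat) (F : smooth_complete_fan RR n r).
Implicit Types (s t : {set 'I_r}) (u w : 'rV[int]_n) (D : 'rV[int]_r).

Notation cone s := (@cone RR n r (ray F) s).
Notation intmx u := (map_mx (intr : int -> RR) u).

Definition dual_family s (e : 'I_r -> 'cV[int]_n) :=
  forall i j, i \in s -> j \in s -> pairing (e i) (ray F j) = (i == j)%:R.

(** The rays of s are rows of B, so the matching columns of the inverse of B are
    dual to them; the relation with B is what shows later that a maximal cone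
    uses all the rows. *)
Lemma cone_dual_basis s : s \in cones F ->
  exists2 B : 'M[int]_n, B \in unitmx & exists2 e, dual_family s e &
    forall i, i \in s ->
      exists2 k, ray F i = row k B & e i = col k (invmx B).
Proof.
move=> /(fan_smooth (s := s))[B uB rB]; exists B => //.
pose e i := if [pick k | ray F i == row k B] is Some k
            then col k (invmx B) else 0.
have eP i : i \in s -> exists2 k, ray F i = row k B & e i = col k (invmx B).
  move=> si; rewrite /e; case: pickP => [k /eqP rk|none]; first by exists k.
  by have [k rk] := rB i si; have := none k; rewrite rk eqxx.
exists e => // i j si sj; have [k ri ->] := eP i si; have [k' rj _] := eP j sj.
rewrite pairing_col rj -row_mul mulmxV // !mxE; congr (nat_of_bool _)%:R.
apply/eqP/eqP => [kk|ij]; first by apply: (@ray_inj _ _ _ F); rewrite ri rj kk.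
have: row k B = row k' B by rewrite -ri -rj ij.
move/(congr1 (fun u => (u *m invmx B) 0 k)); rewrite -!row_mul !mulmxV // !mxE.
by rewrite eqxx; case: eqP.
Qed.

Lemma cone_dual s : s \in cones F -> exists e, dual_family s e.
Proof. by move/cone_dual_basis=> [B _ [e De _]]; exists e. Qed.

Lemma dual_coord s e (c : 'I_r -> int) i : dual_family s e -> i \in s ->
  pairing (e i) (\sum_(j in s) c j *: ray F j) = c i.
Proof.
move=> De si; rewrite pairing_sumr (bigD1 i) //= big1 ?addr0 => [|j /andP[sj ji]].
  by rewrite pairingZr De // eqxx mulr1.
by rewrite pairingZr De // eq_sym (negbTE ji) mulr0.
Qed.

Lemma intmx_sum s (c : 'I_r -> int) :
  intmx (\sum_(i in s) c i *: ray F i) =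
  \sum_(i in s) (c i)%:~R *: intmx (ray F i).
Proof. rewrite raddf_sum; apply: eq_bigr => i _ /=. by rewrite map_mxZ. Qed.

Lemma intmx_inj : injective (fun u => intmx u).
Proof.
move=> u v /rowP uv; apply/rowP => k; have := uv k; rewrite !mxE.
exact: intr_inj.
Qed.

Lemma pairing_intmx (m : 'cV[int]_n) u :
  (intmx u *m intmx m) 0 0 = (pairing m u)%:~R :> RR.
Proof. by rewrite -map_mxM mxE. Qed.

(** Smoothness turns real cones into integral ones: the coefficients are read off
    by a dual family, which has integral entries. *)
Lemma int_cone s u : s \in cones F ->
  cone s (intmx u) <->
  exists2 c : 'I_r -> int, (forall i, 0 <= c i) &
                           u = \sum_(i in s) c i *: ray F i.
Proof.
move=> sF; split=> [[c [c_ge0 uE]]|[c c_ge0 ->]]; last first.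
  by exists (fun i => (c i)%:~R); rewrite intmx_sum; split=> // i; rewrite ler0z.
have [e De] := cone_dual sF.
have cE i : i \in s -> c i = (pairing (e i) u)%:~R.
  move=> si.
  rewrite -pairing_intmx uE mulmx_suml summxE (bigD1 i) //=.
  rewrite big1 ?addr0 => [|j /andP[sj ji]]; rewrite -scalemxAl mxE pairing_intmx.
    by rewrite De // eqxx mulr1.
  by rewrite De // eq_sym (negbTE ji) mulr0.
exists (fun i => `|pairing (e i) u|) => [i|]; first exact: normr_ge0.
apply: intmx_inj; rewrite uE intmx_sum; apply: eq_bigr => i si.
by rewrite cE // intr_norm -cE // ger0_norm.
Qed.

Lemma ray_neq0 i : ray F i != 0.
Proof.
have [e De] := cone_dual (ray_cone F i).
apply: contra_eq_neq (De i i _ _) => [->||]; rewrite ?inE ?eqxx //.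
by rewrite /pairing mul0mx mxE eq_sym oner_eq0.
Qed.

(** A face is cut out by a form that is nonnegative on the cone, so such a form
    can only vanish on a combination of rays if it vanishes on each ray that
    really occurs in it. *)
Lemma face_support s (c : 'I_r -> RR) (w : 'cV[RR]_n) :
  (forall i, 0 <= c i) -> (forall v, cone s v -> 0 <= (v *m w) 0 0) ->
  ((\sum_(i in s) c i *: intmx (ray F i)) *m w) 0 0 = 0 ->
  forall i, i \in s -> 0 < c i -> (intmx (ray F i) *m w) 0 0 = 0.
Proof.
move=> c_ge0 w_ge0 sum0 i si ci.
have ge0 j : j \in s -> 0 <= (intmx (ray F j) *m w) 0 0.
  move=> sj; apply: w_ge0; exists (fun k => (k == j)%:R); split=> [k|].
    exact: ler0n.
  rewrite (bigD1 j) //= eqxx scale1r big1 ?addr0 // => k /andP[_ /negbTE->].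
  by rewrite scale0r.
have E : (\sum_(j in s) c j *: intmx (ray F j) *m w) 0 0 =
         \sum_(j in s) c j * (intmx (ray F j) *m w) 0 0.
  by rewrite summxE; apply: eq_bigr => j _; rewrite -scalemxAl mxE.
move: sum0; rewrite mulmx_suml E => /eqP; rewrite psumr_eq0; last first.
  by move=> j sj; rewrite mulr_ge0 // ge0.
move/allP/(_ i (mem_index_enum _)); rewrite si /= mulf_eq0 gt_eqF //= => /eqP.
by [].
Qed.

Lemma cone_ray s i : i \in s -> cone s (intmx (ray F i)).
Proof.
move=> si; exists (fun k => (k == i)%:R); split=> [k|]; first exact: ler0n.
rewrite (bigD1 i) //= eqxx scale1r big1 ?addr0 // => k /andP[_ /negbTE->].
by rewrite scale0r.
Qed.

(** Since cone t meets the ray i in a face of cone t, some generator of t is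
    proportional to ray i, and both are primitive. *)
Lemma ray_in_cone t i : t \in cones F -> cone t (intmx (ray F i)) -> i \in t.
Proof.
move=> tF tri; have iF := ray_cone F i.
have [w [w_ge0 faceE]] := fan_inter tF iF.
have iri : cone [set i]%SET (intmx (ray F i)) by apply: cone_ray; rewrite inE.
have : (cone t `&` cone [set i]%SET) (intmx (ray F i)) by split.
rewrite faceE => -[_ wi0].
have [c [c_ge0 rE]] := tri.
have [j tj cj] : exists2 j, j \in t & 0 < c j.
  apply: contrapT => none; move/eqP: (ray_neq0 i); apply.
  apply: intmx_inj; rewrite rE map_mx0 big1 // => j tj.
  have -> : c j = 0.
    apply/eqP; rewrite eq_le c_ge0 andbT leNgt; apply/negP => cj.
    by apply: none; exists j.
  by rewrite scale0r.
have wj0 : (intmx (ray F j) *m w) 0 0 = 0.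
  by apply: (face_support (s := t) c_ge0 w_ge0 _ tj cj); rewrite -rE.
have : (cone t `&` cone [set i]%SET) (intmx (ray F j)).
  by rewrite faceE; split=> //; exact: cone_ray.
case=> _ /int_cone-/(_ iF)[a a_ge0]; rewrite big_set1 => jE.
have ai : 0 < a i.
  rewrite lt_def a_ge0 andbT; apply: contraNneq (ray_neq0 j) => a0.
  by rewrite jE a0 scale0r.
have [b b_ge0] : exists2 b : 'I_r -> int, (forall k, 0 <= b k) &
    ray F i = \sum_(k in [set j]%SET) b k *: ray F k.
  apply/int_cone; first exact: ray_cone.
  exists (fun=> (a i)%:~R^-1); split=> [_|]; first by rewrite invr_ge0 ler0z ltW.
  rewrite big_set1 jE map_mxZ /= scalerA mulVf ?scale1r // intr_eq0.
  by rewrite gt_eqF.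
rewrite big_set1 jE scalerA => iE.
have [e De] := cone_dual iF.
have := De i i; rewrite !inE eqxx => /(_ isT isT) ei.
have ba : b j * a i = 1.
  by move: iE => /(congr1 (pairing (e i))); rewrite pairingZr ei mulr1 => <-.
have a1 : a i = 1.
  have b_neq0 : b j != 0 by apply: contra_eq_neq ba => ->; rewrite mul0r.
  move: ba ai (b_ge0 j) b_neq0; move: (b j) (a i) => x y; clear; nia.
have -> // : i = j by apply: (@ray_inj _ _ _ F); rewrite jE a1 scale1r.
Qed.

(** The sum of the rays of s is interior to the cone of s, so the face in which
    cone s meets cone t must be all of cone s. *)
Lemma relint_subset s t : s \in cones F -> t \in cones F ->
  cone t (intmx (\sum_(i in s) ray F i)) -> s \subset t.
Proof.
move=> sF tF tv; have [w [w_ge0 faceE]] := fan_inter sF tF.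
have vE : intmx (\sum_(i in s) ray F i) =
          \sum_(i in s) (1 : RR) *: intmx (ray F i).
  by rewrite raddf_sum; apply: eq_bigr => i _; rewrite scale1r.
have : (cone s `&` cone t) (intmx (\sum_(i in s) ray F i)).
  by split=> //; exists (fun=> 1); rewrite vE.
rewrite faceE vE => -[_ wv0].
apply/fintype.subsetP => i si; apply: ray_in_cone => //.
have : (cone s `&` cone t) (intmx (ray F i)).
  rewrite faceE; split; first exact: cone_ray.
  exact: (face_support (c := fun=> 1) _ w_ge0 wv0 si ltr01).
by case.
Qed.

(** An integral form of closedness: K u + w is the direction u + w / K, which
    tends to u.  If two values of K give points of the cone, then u lies in its
    span, and its coordinates are nonnegative as soon as K exceeds those of w. *)
Lemma cone_limit t u w : t \in cones F -> exists K0 : nat,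
  forall K : nat, (K0 <= K)%N ->
    cone t (intmx (K%:Z *: u + w)) -> cone t (intmx u).
Proof.
move=> tF.
have [[K1 K1t]|none] := pselect (exists K : nat, cone t (intmx (K%:Z *: u + w)));
  last by exists 0%N => K _ Kt; case: none; exists K.
have [e De] := cone_dual tF.
exists (K1 + \sum_i `|pairing (e i) w|%N).+1 => K leK Kt.
have [c1 c1_ge0 E1] := (int_cone _ tF).1 K1t.
have [c c_ge0 E] := (int_cone _ tF).1 Kt.
apply/int_cone => //.
have uE : (K%:Z - K1%:Z) *: u = \sum_(i in t) (c i - c1 i) *: ray F i.
  rewrite scalerBl; transitivity ((K%:Z *: u + w) - (K1%:Z *: u + w)).
    by rewrite opprD addrACA subrr addr0.
  by rewrite E E1 -sumrB; apply: eq_bigr => i _; rewrite scalerBl.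
have KK1 : K%:Z - K1%:Z != 0 by lia.
have cE i : i \in t -> c i - c1 i = (K%:Z - K1%:Z) * pairing (e i) u.
  move=> ti; rewrite -pairingZr uE.
  by rewrite (dual_coord (fun i => c i - c1 i) De ti).
have eu_ge0 i : i \in t -> 0 <= pairing (e i) u.
  move=> ti; have: 0 <= pairing (e i) (K%:Z *: u + w).
    by rewrite E (dual_coord _ De ti).
  rewrite pairingDr pairingZr; move: leK; rewrite (bigD1 i) //=.
  by set x := pairing _ u; set y := pairing _ w; nia.
exists (fun i => `|pairing (e i) u|) => [i|]; first exact: normr_ge0.
apply/rowP => k; apply: (mulfI KK1).
move/rowP/(_ k): uE; rewrite mxE => ->; rewrite !summxE mulr_sumr.
apply: eq_bigr => i ti; rewrite mxE [RHS in _ = RHS]mulrC mxE cE //.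
by rewrite ger0_norm ?eu_ge0 //; ring.
Qed.

(** Completeness puts K u + w in some cone for every K; as there are finitely
    many cones, one K is beyond all the bounds of [cone_limit]. *)
Lemma nearby_cone u w : exists K : nat, exists2 t, t \in cones F &
  cone t (intmx (K%:Z *: u + w)) /\ cone t (intmx u).
Proof.
have /choice[f fP] : forall t, exists K0 : nat, t \in cones F ->
    forall K : nat, (K0 <= K)%N ->
      cone t (intmx (K%:Z *: u + w)) -> cone t (intmx u).
  move=> t; have [tF|] := boolP (t \in cones F); last by exists 0%N.
  by have [K0 K0P] := cone_limit u w tF; exists K0.
exists (\max_t f t); set K := \max_t f t.
have [t tF tK] := fan_complete F (intmx (K%:Z *: u + w)).
exists t => //; split=> //; apply: (fP t tF K) => //.
exact: (leq_bigmax t).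
Qed.

Lemma max_cone_in s : s \in max_cones F -> s \in cones F.
Proof. by rewrite inE => /maxsetp. Qed.

Lemma max_cone_eq s t : s \in max_cones F -> t \in cones F -> s \subset t ->
  s = t.
Proof. by rewrite inE => /maxsetP[_ smax] tF /(smax _ tF). Qed.

Lemma max_cone_above t : t \in cones F ->
  exists2 s, s \in max_cones F & t \subset s.
Proof.
move=> tF; have [s smax ts] := @maxset_exists _ (fun t => t \in cones F) _ tF.
by exists s => //; rewrite inE.
Qed.

(** In a complete fan a maximal cone s is full-dimensional.  Otherwise some row w
    of B is not a ray of s; moving from an interior point of s slightly in the
    direction w leads into a cone that contains the interior point, hence
    contains s, hence is s, although w is outside the span of s. *)
Lemma max_cone_dual s : s \in max_cones F ->
  exists2 e, dual_family s e &
    forall u, u = \sum_(i in s) pairing (e i) u *: ray F i.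
Proof.
move=> smax; have sF := max_cone_in smax.
have [B uB [e De eB]] := cone_dual_basis sF; exists e => // u.
have allk k : exists2 i, i \in s & e i = col k (invmx B).
  apply: contrapT => none.
  pose f := col k (invmx B); pose v := \sum_(i in s) ray F i.
  have fs i : i \in s -> pairing f (ray F i) = 0.
    move=> si; have [k' ri ei] := eB i si.
    rewrite pairing_col ri -row_mul mulmxV // !mxE; case: eqP => // kk.
    by case: none; exists i => //; rewrite ei kk.
  have [K [t tF [tK tv]]] := nearby_cone v (row k B).
  have := max_cone_eq smax tF (relint_subset sF tF tv) => st.
  move: tK; rewrite -st => /int_cone-/(_ sF)[c _ /(congr1 (pairing f))].
  rewrite pairingDr pairingZr pairing_sumr [X in _ * X]big1 // mulr0 add0r.
  rewrite pairing_sumr big1 => [|i si]; last by rewrite pairingZr fs // mulr0.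
  by rewrite pairing_col -row_mul mulmxV // !mxE eqxx.
apply/eqP; rewrite -subr_eq0; apply/eqP; set z := u - _.
suff zB : z *m invmx B = 0 by rewrite -[z](mulmxKV uB) zB mul0mx.
apply/rowP => k; rewrite [RHS]mxE -pairing_col.
have [i si <-] := allk k; rewrite /z pairingDr -scaleN1r pairingZr.
by rewrite (dual_coord (fun i => pairing (e i) u) De si) mulN1r subrr.
Qed.

Lemma max_cone_cover u : exists2 s, s \in max_cones F &
  exists2 c : 'I_r -> int, (forall i, 0 <= c i) &
                           u = \sum_(i in s) c i *: ray F i.
Proof.
have [t tF /int_cone-/(_ tF)[c c_ge0 uE]] := fan_complete F (intmx u).
have [s smax ts] := max_cone_above tF; exists s => //.
exists (fun i => if i \in t then c i else 0) => [i|]; first by case: ifP.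
rewrite uE [RHS](big_setID t) /= [X in _ + X]big1 => [|i]; last first.
  by rewrite inE => /andP[/negbTE-> _]; rewrite scale0r.
by rewrite addr0 (finset.setIidPr ts); apply: eq_bigr => i ->.
Qed.

(** If i were alone in s, all lattice vectors would be multiples of one vector. *)
Lemma max_cone_two_rays s i : n <> 1%N -> s \in max_cones F -> i \in s ->
  exists2 j, j \in s & j != i.
Proof.
move=> n1 smax si; apply: contrapT => none.
have [e De uE] := max_cone_dual smax.
have sE u : u = pairing (e i) u *: ray F i.
  rewrite {1}(uE u) (bigD1 i) //= big1 ?addr0 // => j /andP[sj ji].
  by case: none; exists j.
have [p [q pq]] : exists p q : 'I_n, p != q.
  move: (ray_neq0 i) n1; case: n (ray F i) => [|[|m]] // v.
    by case/eqP; apply/rowP; case.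
  by exists ord0, ord_max.
have dE k k' : (k' == k)%:R = pairing (e i) (delta_mx 0 k) * ray F i 0 k'.
  have /(congr1 (fun u : 'rV_n => u 0 k')) := sE (delta_mx 0 k).
  by rewrite !mxE eqxx.
have := dE p p; have := dE q q; have := dE p q.
rewrite !eqxx eq_sym (negbTE pq).
set a := pairing _ _; set b := pairing _ _; move=> /esym /eqP.
by rewrite mulf_eq0 => /orP[]/eqP->; rewrite ?mul0r ?mulr0.
Qed.

End FanGeometry.

(** * Divisor classes in the chart of a maximal cone *)

Section ClassGroupCharts.
Variables (RR : realType) (n r : nat) (F : smooth_complete_fan RR n r).
Implicit Types (s t : {set 'I_r}) (u : 'rV[int]_n) (m : 'cV[int]_n).
Implicit Types (D : 'rV[int]_r) (alpha beta : Cl F) (a : 'X_{1..r}).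

Definition dual_basis s (e : 'I_r -> 'cV[int]_n) := dual_family F s e /\
  forall u, u = \sum_(i in s) pairing (e i) u *: ray F i.

Definition dual s : 'I_r -> 'cV[int]_n := xget (fun=> 0) (dual_basis s).

Lemma dualP s : s \in max_cones F -> dual_basis s (dual s).
Proof.
move=> /max_cone_dual[e De uE].
by apply: (@xgetPex _ _ (dual_basis s)); exists e.
Qed.

Lemma max_cone_char_eq s m1 m2 : s \in max_cones F ->
  (forall i, i \in s -> pairing m1 (ray F i) = pairing m2 (ray F i)) -> m1 = m2.
Proof.
move=> /dualP[_ uE] eq12; apply: pairing_inj => u.
rewrite (uE u) !pairing_sumr; apply: eq_bigr => i si.
by rewrite !pairingZr eq12.
Qed.

(** The local equation of D at the torus fixed point of s. *)
Definition char_of s D : 'cV[int]_n := \sum_(j in s) D 0 j *: dual s j.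

Lemma pairing_char_of s D i : s \in max_cones F -> i \in s ->
  pairing (char_of s D) (ray F i) = D 0 i.
Proof.
move=> /dualP[De _] si; rewrite pairing_suml (bigD1 i) //= pairingZl De // eqxx.
rewrite mulr1 big1 ?addr0 // => j /andP[sj /negbTE ji].
by rewrite pairingZl De // ji mulr0.
Qed.

Lemma div_charE m i : div_char F m 0 i = pairing m (ray F i).
Proof. by rewrite mxE. Qed.

Lemma div_char0 : div_char F 0 = 0.
Proof. by rewrite -(subrr 0) div_charB subrr. Qed.

Lemma cl_eq D1 D2 : cl F D1 = cl F D2 <-> exists m, D1 = D2 + div_char F m.
Proof.
have -> : (cl F D1 = cl F D2) <-> (D1 - D2 \in @principal RR n r F).
  by rewrite Quotient.idealrBE; split=> /eqP.
split=> [/asboolP[m DE]|[m ->]]; first by exists m; rewrite -DE addrC subrK.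
by apply/asboolP; exists m; rewrite addrC addKr.
Qed.

Lemma clD D1 D2 : cl F (D1 + D2) = cl F D1 + cl F D2.
Proof. exact: raddfD. Qed.

(** The only divisor in the class alpha that is supported away from the torus
    fixed point of s.  For nef alpha its coefficients are the lattice
    distances from the vertex s of the polytope of alpha to the facets. *)
Definition local_divisor s alpha : 'rV[int]_r :=
  repr alpha - div_char F (char_of s (repr alpha)).

Lemma cl_local_divisor s alpha : cl F (local_divisor s alpha) = alpha.
Proof.
rewrite -[RHS]reprK; apply/cl_eq; exists (0 - char_of s (repr alpha)).
by rewrite div_charB div_char0 sub0r.
Qed.

Lemma local_divisor_on s alpha i : s \in max_cones F -> i \in s ->
  local_divisor s alpha 0 i = 0.
Proof.
by move=> smax si; rewrite mxE [X in _ + X]mxE div_charE pairing_char_of // subrr.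
Qed.

Lemma local_divisor_unique s alpha D : s \in max_cones F -> cl F D = alpha ->
  (forall i, i \in s -> D 0 i = 0) -> D = local_divisor s alpha.
Proof.
move=> smax; rewrite -{1}(cl_local_divisor s alpha) => /cl_eq[m DE] D0.
suff m0 : m = 0.
  by rewrite DE m0 div_char0 addr0.
apply: (max_cone_char_eq smax) => i si.
have := D0 i si; rewrite DE mxE local_divisor_on // add0r div_charE => ->.
by rewrite /pairing mulmx0 mxE.
Qed.

Lemma local_divisorD s alpha beta : s \in max_cones F ->
  local_divisor s (alpha + beta) = local_divisor s alpha + local_divisor s beta.
Proof.
move=> smax; apply/esym/local_divisor_unique => // [|i si].
  by rewrite clD !cl_local_divisor.
by rewrite mxE !local_divisor_on // addr0.
Qed.

Lemma local_divisor0 s : s \in max_cones F -> local_divisor s 0 = 0.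
Proof.
move=> smax; apply: (addrI (local_divisor s 0)).
by rewrite addr0 -local_divisorD // addr0.
Qed.

Lemma local_divisorMn s alpha k : s \in max_cones F ->
  local_divisor s (alpha *+ k) = local_divisor s alpha *+ k.
Proof.
move=> smax; elim: k => [|k IHk]; first by rewrite !mulr0n local_divisor0.
by rewrite !mulrS local_divisorD // IHk.
Qed.

Lemma divisor_of_class s D alpha : cl F D = alpha ->
  exists m, D = local_divisor s alpha + div_char F m.
Proof. by move=> <-; apply/cl_eq; rewrite cl_local_divisor. Qed.

(** The absolute value is a mere cast: only effective divisors D matter. *)
Definition monomial_of D : 'X_{1..r} := [multinom `|D ord0 i|%N | i < r].

Lemma monomial_ofE D i : 0 <= D 0 i -> (monomial_of D i)%:Z = D 0 i.
Proof. by move=> D_ge0; rewrite mnmE gez0_abs. Qed.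

Lemma deg_monomial_of D : (forall i, 0 <= D 0 i) ->
  deg F (monomial_of D) = cl F D.
Proof.
by move=> D_ge0; congr (cl F _); apply/rowP => i; rewrite mxE monomial_ofE.
Qed.

Lemma nefP alpha : nef alpha <->
  forall s, s \in max_cones F -> forall i, 0 <= local_divisor s alpha 0 i.
Proof.
split=> nefA s smax; last first.
  exists (monomial_of (local_divisor s alpha)).
  split=> [|i si]; last by rewrite mnmE local_divisor_on.
  by rewrite deg_monomial_of ?cl_local_divisor //; exact: nefA.
move=> i; have [a [degA a0]] := nefA s smax.
rewrite -(local_divisor_unique smax degA) ?mxE // => j sj.
by rewrite mxE a0.
Qed.

Lemma nef0 : nef (0 : Cl F).
Proof. by apply/nefP => s smax i; rewrite local_divisor0 // mxE. Qed.

Lemma nef_sub_le alpha alpha0 s i : s \in max_cones F -> nef (alpha - alpha0) ->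
  local_divisor s alpha0 0 i <= local_divisor s alpha 0 i.
Proof.
move=> smax /nefP/(_ s smax i).
have := local_divisorD (alpha - alpha0) alpha0 smax; rewrite subrK.
by move/rowP/(_ i); rewrite [RHS]mxE => ->; rewrite lerDr.
Qed.

(** Monomials of degree alpha as lattice points, with the vertex s as origin. *)
Lemma deg_eqP alpha s a : deg F a = alpha -> exists m,
  forall i, (a i)%:Z = local_divisor s alpha 0 i + pairing m (ray F i).
Proof.
move=> /(divisor_of_class s)[m DE]; exists m => i.
by move/rowP/(_ i): DE; rewrite mxE [RHS]mxE div_charE.
Qed.

End ClassGroupCharts.

(** * The Hilbert function of a monomial ideal counts standard monomials *)

Section MonomialQuotient.
Variables (RR : realType) (n r : nat) (F : smooth_complete_fan RR n r).
Variable gens : seq 'X_{1..r}.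
Implicit Types (alpha : Cl F) (a g : 'X_{1..r}) (f : {mpoly RR[i][r]}).

Notation ideal := (@monomial_ideal RR r gens).

Definition outside_ideal a := forall g, g \in gens -> exists i, (a i < g i)%N.

Definition standard alpha : set 'X_{1..r} :=
  [set a | deg F a = alpha /\ outside_ideal a].

Lemma ideal_coef f a : ideal f -> outside_ideal a -> f@_a = 0.
Proof.
move=> [q ->] outA; rewrite raddf_sum big1 //= => k _.
have [i lt_ag] := outA _ (mem_tnth k (in_tuple gens)).
rewrite mcoeffM big1 // => -[a1 a2] /= /eqP aE; rewrite mcoeffX.
case: eqP => [ga2|_]; last by rewrite mulr0.
have := congr1 (fun b : 'X_{1..r} => b i) aE.
by rewrite /= -ga2 mnmDE => aiE; move: lt_ag; rewrite aiE ltnNge leq_addl.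
Qed.

Lemma idealD f1 f2 : ideal f1 -> ideal f2 -> ideal (f1 + f2).
Proof.
move=> [q1 ->] [q2 ->]; exists (fun k => q1 k + q2 k); rewrite -big_split /=.
by apply: eq_bigr => k _; rewrite mulrDl.
Qed.

Lemma ideal_monomial c g a : g \in gens -> (g <= a)%MM -> ideal (c *: 'X_[a]).
Proof.
move=> /(tnthP (in_tuple gens))[k0 ->] le_ga.
set g0 := tnth _ _ in le_ga *.
exists (fun k => if k == k0 then c *: 'X_[(a - g0)%MM] else 0).
rewrite (bigD1 k0) //= eqxx big1 ?addr0 => [|k /negbTE->]; last by rewrite mul0r.
by rewrite -scalerAl -mpolyXD submK.
Qed.

Lemma ideal_mem f : (forall a, a \in msupp f -> ~ outside_ideal a) -> ideal f.
Proof.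
move=> suppf; rewrite (mpolyE f).
have : forall a, a \in msupp f -> ideal (f@_a *: 'X_[a]).
  move=> a /suppf outA; apply: contrapT => notI; apply: outA => g gG.
  apply: contrapT => none; apply: notI; apply: ideal_monomial gG _.
  apply/mnm_lepP => i; rewrite leqNgt; apply/negP => lt_ag.
  by apply: none; exists i.
elim: (msupp f) => [|a s IHs] idealS.
  by rewrite big_nil; exists (fun=> 0); rewrite big1 // => k _; rewrite mul0r.
rewrite big_cons; apply: idealD; first by apply: idealS; rewrite mem_head.
by apply: IHs => b bs; apply: idealS; rewrite inE bs orbT.
Qed.

Lemma hilbert_function_size alpha (S : seq 'X_{1..r}) : uniq S ->
  (forall a, a \in S <-> standard alpha a) ->
  hilbert_function gens alpha (size S).
Proof.
move=> uS SE; pose a_ k := tnth (in_tuple S) k.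
have a_S k : a_ k \in S by exact: mem_tnth.
have a_inj : injective a_ by apply/tuple_uniqP.
exists (fun k => 'X_[a_ k]); split=> [k a|v Uv].
  by rewrite msuppX inE => /eqP->; have /SE[] := a_S k.
have coefE (c : 'rV[RR[i]]_(size S)) j :
    (v - \sum_i c 0 i *: 'X_[a_ i])@_(a_ j) = v@_(a_ j) - c 0 j.
  rewrite mcoeffB raddf_sum (bigD1 j) //= big1 ?addr0 => [|k /negbTE kj].
    by rewrite mcoeffZ mcoeffX eqxx mulr1.
  by rewrite mcoeffZ mcoeffX (inj_eq a_inj) kj mulr0.
exists (\row_j v@_(a_ j)); split=> [|c Wc]; last first.
  apply/rowP => j; rewrite mxE; apply/eqP; rewrite -subr_eq0 -coefE.
  by apply/eqP/(ideal_coef Wc); have /SE[] := a_S j.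
apply: ideal_mem => a suppA outA; have : a \in S.
  apply/SE; split=> //; move: suppA => /msuppB_le; rewrite mem_cat.
  case/orP=> [/Uv //|]; move=> /msupp_sum_le /flatten_mapP[k _].
  by move=> /msuppZ_le; rewrite msuppX inE => /eqP->; have /SE[] := a_S k.
move=> /(tnthP (in_tuple S))[j aE]; move: suppA.
by rewrite aE mcoeff_msupp coefE mxE subrr eqxx.
Qed.

(** Modulo the ideal, independent standard monomials are combinations of d
    vectors: reading off their coefficients factors an identity matrix through
    dimension d. *)
Lemma hilbert_function_bound alpha d (S : seq 'X_{1..r}) : uniq S ->
  (forall a, a \in S -> standard alpha a) ->
  hilbert_function gens alpha d -> (size S <= d)%N.
Proof.
move=> uS SE [b [_ bP]]; pose a_ k := tnth (in_tuple S) k.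
have a_S k : a_ k \in S by exact: mem_tnth.
have a_inj : injective a_ by apply/tuple_uniqP.
have /choice[c cP] : forall k, exists c : 'rV[RR[i]]_d,
    ideal ('X_[a_ k] - \sum_i c 0 i *: b i).
  move=> k; have [|c [Wc _]] := bP 'X_[a_ k]; last by exists c.
  by move=> a; rewrite msuppX inE => /eqP->; have [] := SE _ (a_S k).
pose C := \matrix_(k < size S, i < d) c k 0 i.
pose B := \matrix_(i < d, k < size S) (b i)@_(a_ k).
have CB : C *m B = 1%:M.
  apply/matrixP => k l; rewrite !mxE.
  have [_ outL] := SE _ (a_S l).
  have := ideal_coef (cP k) outL; rewrite mcoeffB raddf_sum /= mcoeffX.
  rewrite (inj_eq a_inj) => /eqP; rewrite subr_eq0 => /eqP->.
  by apply: eq_bigr => i _; rewrite !mxE mcoeffZ.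
have := mxrankM_maxl C B; rewrite CB mxrank1 => /leq_trans; apply.
exact: rank_leq_col.
Qed.

End MonomialQuotient.

(** * The Klyachko diagram *)

Section KlyachkoDiagram.
Variables (RR : realType) (n r : nat) (F : smooth_complete_fan RR n r).
Variable gens : seq 'X_{1..r}.
Implicit Types (s : {set 'I_r}) (m : 'cV[int]_n) (a g : 'X_{1..r}).

Lemma min_deg_le g i : g \in gens -> (min_deg gens i <= g i)%N.
Proof.
rewrite /min_deg; set x := (X in \big[_/X]_(_ <- _) _); move: x => x.
elim: gens => // a G IHG; rewrite inE big_cons => /orP[/eqP->|/IHG].
  exact: geq_minl.
by apply: leq_trans; exact: geq_minr.
Qed.

Lemma klyachko_Delta_rec_cons i i' cs g0 (S0 : seq 'X_{1..r}) :
  let T := sort (fun a b : 'X_{1..r} => (a i <= b i)%N) (g0 :: S0) in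
  klyachko_Delta_rec F gens [:: i, i' & cs] (g0 :: S0) =
  \bigcup_(j in `I_(size T).+1)
    (slab F gens i T j `&` klyachko_Delta_rec F gens (i' :: cs) (take j T)).
Proof. by []. Qed.

(** The recursion sorts the generators along one ray.  Those whose degree m has
    not reached do not divide m, as this ray shows; the others form a prefix of
    the sorted list, and the remaining rays must exclude them. *)
Lemma klyachko_Delta_recP cs (S : seq 'X_{1..r}) m : {subset S <= gens} ->
  klyachko_Delta_rec F gens cs S m <->
  (forall i, i \in cs -> (min_deg gens i)%:Z <= pairing m (ray F i)) /\
  (forall g, g \in S -> exists2 i, i \in cs & pairing m (ray F i) < (g i)%:Z).
Proof.
elim: cs S => [|i cs IHcs] [|g0 S0] sub.
- by split=> [|[]].
- by split=> // -[_ /(_ g0)]; rewrite mem_head => /(_ isT)[].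
- by split=> [|[]].
set S := g0 :: S0 in sub *.
pose T := sort (fun a b : 'X_{1..r} => (a i <= b i)%N) S.
pose x := pairing m (ray F i).
have TS : T =i S by exact: mem_sort.
have T_sorted : sorted (fun a b : 'X_{1..r} => (a i <= b i)%N) T.
  by apply: sort_sorted => a b; exact: leq_total.
have le_nth j k : (j <= k < size T)%N -> (nth 0%MM T j i <= nth 0%MM T k i)%N.
  move=> /andP[jk kT].
  apply: (sorted_leq_nth _ _ 0%MM T_sorted) (jk) => [b a c|a||].
  - exact: leq_trans.
  - exact: leqnn.
  - by rewrite inE (leq_ltn_trans jk).
  - by rewrite inE.
have T0 : (0 < size T)%N by rewrite size_sort.
have minT j : (j < size T)%N -> (min_deg gens i)%:Z <= (nth 0%MM T j i)%:Z.
  by move=> jT; rewrite lez_nat min_deg_le // sub // -TS mem_nth.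
have gT g : g \in S -> exists2 k, (k < size T)%N & g = nth 0%MM T k.
  rewrite -TS => gT; exists (index g T); first by rewrite index_mem.
  by rewrite nth_index.
case: cs IHcs => [|i' cs'] IHcs.
  split=> [[lb ub]|[lb ub]]; split=> /=.
  - by move=> j; rewrite inE => /eqP->.
  - move=> g /gT[k kT ->]; exists i; first by rewrite inE.
    by apply: lt_le_trans (ub T0) _; rewrite lez_nat le_nth.
  - by apply: lb; rewrite inE.
  - move=> _; have [|j] := ub (nth 0%MM T 0); first by rewrite -TS mem_nth.
    by rewrite inE => /eqP->.
rewrite klyachko_Delta_rec_cons -/S -/T.
move: (i' :: cs') IHcs => cs IHcs {i' cs'}.
have subT j : {subset take j T <= gens}.
  by move=> g /mem_take; rewrite TS => /sub.
split=> [[j /= jT [[lb ub] /IHcs[|lb' ub']]]|[lb ub]].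
- exact: subT.
- split=> [k|g /gT[k kT ->]].
    rewrite inE => /orP[/eqP->|/lb' //].
    case: j jT lb {ub lb' ub'} => [|j] //= jT; apply: le_trans.
    exact: minT.
  have [jk|kj] := leqP j k.
    exists i; first by rewrite mem_head.
    by apply: lt_le_trans (ub (leq_ltn_trans jk kT)) _; rewrite lez_nat le_nth // jk.
  have [|i1 i1cs lt] := ub' (nth 0%MM T k).
    by rewrite -(nth_take _ kj) mem_nth // size_take; case: ifP.
  by exists i1; rewrite // inE i1cs orbT.
(* The slab of m is the number of generators whose degree m has reached. *)
pose p (a : 'X_{1..r}) := x < (a i)%:Z.
exists (find p T); first by rewrite /= ltnS find_size.
split; first split.
- case jE: (find p T) => [|j]; first by apply: lb; rewrite mem_head.
  by have := @before_find _ 0%MM p T j; rewrite jE ltnSn /p ltNge => /(_ isT)/negbFE.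
- by rewrite -has_find => /(nth_find 0%MM).
apply/IHcs; first exact: subT.
split=> [k kcs|g]; first by apply: lb; rewrite inE kcs orbT.
move=> gtake; have [|k] := ub g; first by rewrite -TS (mem_take gtake).
rewrite inE => /orP[/eqP-> gx|]; last by exists k.
have ix : (index g (take (find p T) T) < find p T)%N.
  apply: leq_trans (_ : size (take (find p T) T) <= _)%N.
    by rewrite index_mem.
  by rewrite size_take; case: ltnP.
have := before_find 0%MM ix; rewrite -(nth_take 0%MM ix) nth_index //.
by rewrite /p gx.
Qed.

Lemma klyachko_DeltaP s m : klyachko_Delta F gens s m <->
  (forall i, i \in s -> (min_deg gens i)%:Z <= pairing m (ray F i)) /\
  (forall g, g \in gens -> exists2 i, i \in s & pairing m (ray F i) < (g i)%:Z).
Proof.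
have recP := @klyachko_Delta_recP (rev (enum s)) gens m (fun _ => id).
split=> [/recP[lb ub]|[lb ub]]; [|apply/recP]; split=> [i si|g /ub[i si lt]].
- by apply: lb; rewrite mem_rev mem_enum.
- by exists i; rewrite // -mem_enum -mem_rev.
- by apply: lb; rewrite -mem_enum -mem_rev.
- by exists i; rewrite // mem_rev mem_enum.
Qed.

(** On the chart of s, where the other variables are invertible, the ideal
    contains a power of each coordinate x_i: its zero set is contained in the
    set of torus fixed points. *)
Definition finite_support := forall s, s \in max_cones F -> forall i, i \in s ->
  exists2 g, g \in gens & forall j, j \in s -> j != i -> g j = 0%N.

Lemma finite_set_bounded (T : choiceType) (A : set T) (f : T -> nat) :
  finite_set A -> exists N, forall x, A x -> (f x <= N)%N.
Proof.
move=> finA; exists (\max_(x <- fset_set A) f x) => x Ax.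
by apply: leq_bigmax_seq => //; rewrite in_fset_set // inE.
Qed.

Definition deg_bound := (\max_(g <- gens) \max_i g i).+1.

Lemma deg_boundP g i : g \in gens -> (g i < deg_bound)%N.
Proof.
move=> gG; rewrite ltnS; apply: leq_trans (_ : \max_i g i <= _)%N.
  exact: (leq_bigmax i).
exact: (leq_bigmax_seq (F := fun g : 'X_{1..r} => \max_i g i)%N g).
Qed.

Lemma Delta_lt_deg_bound s m i : finite_support -> s \in max_cones F ->
  klyachko_Delta F gens s m -> i \in s -> pairing m (ray F i) < deg_bound%:Z.
Proof.
move=> finG smax /klyachko_DeltaP[lb ub] si.
have [g gG g0] := finG s smax i si; have [j sj] := ub g gG.
have [->|ji] := eqVneq j i.
  by move=> lt; apply: lt_trans lt _; rewrite ltz_nat deg_boundP.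
by rewrite g0 // ltNge (le_trans _ (lb j sj)).
Qed.

(** A character is determined by its values on the rays of s, and these are
    between 0 and [deg_bound]. *)
Lemma finite_support_Delta s : finite_support -> s \in max_cones F ->
  finite_set (klyachko_Delta F gens s).
Proof.
move=> finG smax.
pose h (f : {ffun 'I_r -> 'I_deg_bound}) :=
  char_of F s (\row_i (f i : nat)%:Z).
apply: (@sub_finite_set _ _ (h @` [set: {ffun 'I_r -> 'I_deg_bound}])); last first.
  by apply: finite_image; exact: finite_finset.
move=> m mD; have [lb _] := (klyachko_DeltaP s m).1 mD.
exists [ffun i => inord `|pairing m (ray F i)|%N] => //.
apply: (max_cone_char_eq smax) => i si; rewrite pairing_char_of // mxE ffunE.
have := Delta_lt_deg_bound finG smax mD si.
have := lb i si; move: (pairing m _) => x x_min x_lt; have x_ge0 : 0 <= x by lia.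
by rewrite inordK ?gez0_abs // -/deg_bound -ltz_nat gez0_abs.
Qed.

(** If no generator is a local power of x_i at s, all the powers of x_i are in
    Delta: each generator involves another variable of the chart. *)
Lemma Delta_finite_support :
  (forall i, min_deg gens i = 0%N) ->
  (forall s, s \in max_cones F -> finite_set (klyachko_Delta F gens s)) ->
  finite_support.
Proof.
move=> s0 finD s smax i si; apply: contrapT => none.
have [N NP] := finite_set_bounded
  (fun m => `|pairing m (ray F i)|%N) (finD s smax).
have [De _] := dualP smax.
suff /NP : klyachko_Delta F gens s (N.+1%:Z *: dual F s i).
  by rewrite pairingZl De // eqxx mulr1 absz_nat ltnn.
apply/klyachko_DeltaP; split=> [j sj|g gG].
  by rewrite s0 pairingZl De //; case: eqP.
apply: contrapT => none'; apply: none; exists g => // j sj ji.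
have [//|gj] := eqVneq (g j) 0%N; case: none'; exists j => //.
by rewrite pairingZl De // eq_sym (negbTE ji) mulr0 ltz_nat lt0n.
Qed.

(** The power of a neighbour x_j of x_i that the ideal contains locally does not
    involve x_i. *)
Lemma finite_support_min_deg : n <> 1%N -> finite_support ->
  forall i, min_deg gens i = 0%N.
Proof.
move=> n1 finG i; have [s smax] := max_cone_above (ray_cone F i).
rewrite finset.sub1set => si; have [j sj ji] := max_cone_two_rays n1 smax si.
have [g gG g0] := finG s smax j sj.
by apply/eqP; rewrite -leqn0 -(g0 i si) ?min_deg_le // eq_sym.
Qed.

End KlyachkoDiagram.

(** * Growth of the Hilbert function in the direction of an ample class *)

Section HilbertFunction.
Variables (RR : realType) (n r : nat) (F : smooth_complete_fan RR n r).
Variable gens : seq 'X_{1..r}.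
Implicit Types (s : {set 'I_r}) (m : 'cV[int]_n) (a g : 'X_{1..r}).
Implicit Types (alpha beta : Cl F).

(** Strict convexity of the support function of a divisor in the class beta. *)
Definition ample beta := forall s, s \in max_cones F ->
  forall i, i \notin s -> 0 < local_divisor s beta 0 i.

Lemma ample_nef beta k : ample beta -> nef (beta *+ k).
Proof.
move=> ampB; apply/nefP => s smax i; rewrite local_divisorMn // mulmxnE.
apply: mulrn_wge0; have [si|/(ampB s smax)/ltW //] := boolP (i \in s).
by rewrite local_divisor_on.
Qed.

Lemma local_divisor_ample beta alpha0 alpha k s i : ample beta ->
  s \in max_cones F -> nef (alpha - (alpha0 + beta *+ k)) -> i \notin s ->
  local_divisor s alpha0 0 i + k%:Z <= local_divisor s alpha 0 i.
Proof.
move=> ampB smax nefA si; apply: le_trans (nef_sub_le i smax nefA).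
rewrite local_divisorD // [X in _ <= X]mxE lerD2l local_divisorMn // mulmxnE.
by have := ampB s smax i si; move: (local_divisor _ _ _ _) => x; nia.
Qed.

(** Facets that come close to a common lattice point share a vertex, once the
    polytope is large.  Let u be the sum of the rays close to a, and s a cone
    containing u.  Relative to the vertex s, the exponents of a on these rays sum
    to the distances of s to those facets plus <m, u>, and the latter is
    nonnegative because u is a nonnegative combination of the rays of s. *)
Lemma small_rays_in_cone d alpha a : deg F a = alpha ->
  (forall s, s \in max_cones F -> forall i, i \notin s ->
     (r * d)%:Z < local_divisor s alpha 0 i) ->
  exists2 s, s \in max_cones F & forall i, (a i < d)%N -> i \in s.
Proof.
move=> degA bigA; pose T := [set i | (a i < d)%N]%SET.
have [s smax [c c_ge0 uE]] := max_cone_cover F (\sum_(i in T) ray F i).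
exists s => // i ad; apply: contrapT => /negP si.
have [m aE] := deg_eqP s degA.
have loc_ge0 j : 0 <= local_divisor s alpha 0 j.
  have [sj|/(bigA s smax)] := boolP (j \in s); last by lia.
  by rewrite local_divisor_on.
have : \sum_(j in T) (a j)%:Z =
       \sum_(j in T) local_divisor s alpha 0 j +
       \sum_(j in s) c j * (a j)%:Z.
  transitivity (\sum_(j in T) (local_divisor s alpha 0 j + pairing m (ray F j))).
    by apply: eq_bigr => j _; rewrite aE.
  rewrite big_split /= -pairing_sumr uE pairing_sumr; congr (_ + _).
  by apply: eq_bigr => j sj; rewrite pairingZr aE local_divisor_on // add0r.
apply/eqP; rewrite lt_eqF //.
apply: (@le_lt_trans _ _ (r * d)%:Z).
  apply: (@le_trans _ _ (\sum_(j in T) d%:Z)).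
    by apply: ler_sum => j; rewrite inE lez_nat => /ltnW.
  rewrite sumr_const -mulr_natl natz -PoszM lez_nat leq_mul2r.
  by rewrite (leq_trans (max_card _)) ?card_ord ?orbT.
rewrite (bigD1 i) ?inE //= -addrA.
apply: lt_le_trans (bigA s smax i si) _; rewrite lerDl addr_ge0 //.
  by apply: sumr_ge0.
by apply: sumr_ge0 => j _; rewrite mulr_ge0.
Qed.

Lemma Delta_bounded : finite_support F gens -> exists N : nat,
  forall s, s \in max_cones F -> forall m, klyachko_Delta F gens s m ->
  forall p, `|pairing m (ray F p)| <= N%:Z.
Proof.
move=> finG.
have /choice[f fP] : forall s, exists N, s \in max_cones F ->
    forall m, klyachko_Delta F gens s m ->
      (\max_p `|pairing m (ray F p)|%N <= N)%N.
  move=> s; have [smax|] := boolP (s \in max_cones F); last by exists 0%N.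
  have [N NP] := finite_set_bounded (fun m => \max_p `|pairing m (ray F p)|%N)
    (finite_support_Delta finG smax).
  by exists N.
exists (\max_s f s) => s smax m mD p.
have le_s : (f s <= \max_s f s)%N by exact: (leq_bigmax s).
have le_p : (`|pairing m (ray F p)| <= \max_p `|pairing m (ray F p)|)%N.
  exact: (leq_bigmax p).
by have := fP s smax m mD; lia.
Qed.

(** A point m of Delta^s becomes the monomial with exponents <m, rho> along s,
    and along the other rays the large exponents that the degree dictates. *)
Lemma hilbert_function_Delta beta : ample beta ->
  (forall i, min_deg gens i = 0%N) -> finite_support F gens ->
  for_large (fun alpha : Cl F => hilbert_function gens alpha
    (\sum_(s in max_cones F) #|` fset_set (klyachko_Delta F gens s)|)%N).
Proof.
move=> ampB s0 finG; have [N NP] := Delta_bounded finG.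
have finD s := finite_support_Delta (s := s) finG.
pose d := deg_bound gens.
have [k kN krd] : exists2 k, (N <= k)%N & (r * d < k)%N.
  by exists (N + r * d).+1; rewrite ?ltnS ?leq_addl // ltnW // ltnS leq_addr.
exists (0 + beta *+ k) => alpha nefA.
have loc_big s i : s \in max_cones F -> i \notin s ->
    k%:Z <= local_divisor s alpha 0 i.
  move=> smax si; have := local_divisor_ample ampB smax nefA si.
  by rewrite local_divisor0 // mxE add0r.
have loc_rd s : s \in max_cones F -> forall i, i \notin s ->
    (r * d)%:Z < local_divisor s alpha 0 i.
  by move=> smax i si; apply: lt_le_trans (loc_big s i smax si); rewrite ltz_nat.
pose D s m := local_divisor s alpha + div_char F m.
pose mon s m := monomial_of (D s m).
have D_ge0 s m i : s \in max_cones F -> klyachko_Delta F gens s m ->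
    0 <= D s m 0 i.
  move=> smax mD; rewrite mxE div_charE.
  have [si|si] := boolP (i \in s).
    have [lb _] := (klyachko_DeltaP F gens s m).1 mD.
    by rewrite local_divisor_on // add0r; apply: le_trans (lb i si).
  have := loc_big s i smax si; have := NP s smax m mD i; rewrite ler_norml.
  move: (pairing _ _) (local_divisor _ _ _ _) kN; clear => x y kN. lia.
have monE s m i : s \in max_cones F -> klyachko_Delta F gens s m ->
    (mon s m i)%:Z = local_divisor s alpha 0 i + pairing m (ray F i).
  by move=> smax mD; rewrite monomial_ofE ?D_ge0 // mxE div_charE.
have mon_on s m i : s \in max_cones F -> klyachko_Delta F gens s m -> i \in s ->
    (mon s m i)%:Z = pairing m (ray F i).
  by move=> smax mD si; rewrite monE // local_divisor_on // add0r.
have mon_deg s m : s \in max_cones F -> klyachko_Delta F gens s m ->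
    deg F (mon s m) = alpha.
  move=> smax mD; rewrite deg_monomial_of => [|i]; last exact: D_ge0.
  by rewrite -[RHS](cl_local_divisor s); apply/cl_eq; exists m.
(* A monomial remembers its cone: s is the set of its small exponents. *)
have mon_supp s m : s \in max_cones F -> klyachko_Delta F gens s m ->
    forall i, (mon s m i < d)%N = (i \in s).
  move=> smax mD.
  have s_small i : i \in s -> (mon s m i < d)%N.
    by move=> si; rewrite -ltz_nat mon_on // (Delta_lt_deg_bound finG smax mD).
  have [t tmax t_small] := small_rays_in_cone (mon_deg s m smax mD) loc_rd.
  have st : s = t.
    apply: max_cone_eq (max_cone_in tmax) _ => //.
    by apply/fintype.subsetP => i /s_small/t_small.
  by move=> i; apply/idP/idP => [|/s_small //]; rewrite {2}st => /t_small.
pose S := [seq mon s m | s <- enum (max_cones F),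
                         m <- fset_set (klyachko_Delta F gens s)].
have memD s m : s \in max_cones F ->
    m \in fset_set (klyachko_Delta F gens s) -> klyachko_Delta F gens s m.
  by move=> smax; rewrite in_fset_set ?inE //; exact: finD.
have <- : size S =
    (\sum_(s in max_cones F) #|` fset_set (klyachko_Delta F gens s)|)%N.
  by rewrite size_allpairs_dep sumnE big_map big_enum.
apply: hilbert_function_size => [|a].
  apply: allpairs_uniq_dep => [|s _|]; [exact: enum_uniq|exact: fset_uniq|].
  move=> [s m] [s' m'] /allpairsPdep[s1 [m1 [s1max m1D [ss mm]]]].
  move=> /allpairsPdep[s2 [m2 [s2max m2D [ss' mm']]]] /= monEq.
  move: s1max m1D s2max m2D; rewrite -ss -mm -ss' -mm' !mem_enum.
  move=> smax /(memD _ _ smax) mD s'max /(memD _ _ s'max) m'D.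
  have es : s = s'.
    by apply/setP => i; rewrite -(mon_supp s m) // monEq mon_supp.
  rewrite -es in s'max m'D monEq *; congr (existT _ _ _).
  apply: (max_cone_char_eq smax) => i si.
  by rewrite -(mon_on s m) // -(mon_on s m') // monEq.
split=> [/allpairsPdep[s [m [smax mD ->]]]|[degA outA]].
  move: smax mD; rewrite mem_enum => smax /(memD _ _ smax) mD.
  split=> [|g gG]; first exact: mon_deg.
  have [_ /(_ g gG)[i si lt]] := (klyachko_DeltaP F gens s m).1 mD.
  by exists i; rewrite -ltz_nat mon_on.
have [s smax s_small] := small_rays_in_cone degA loc_rd.
have [m aE] := deg_eqP s degA.
have aE_on i : i \in s -> (a i)%:Z = pairing m (ray F i).
  by move=> si; rewrite aE local_divisor_on // add0r.
have mD : klyachko_Delta F gens s m.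
  apply/klyachko_DeltaP; split=> [i si|g gG]; first by rewrite s0 -aE_on.
  have [i lt_ag] := outA g gG.
  have si : i \in s by apply: s_small; apply: ltn_trans lt_ag (deg_boundP i gG).
  by exists i; rewrite // -aE_on // ltz_nat.
apply/allpairsPdep; exists s, m; split; first by rewrite mem_enum.
  by rewrite in_fset_set ?inE //; exact: finD.
by apply/mnmP => i; apply: (can_inj absz_nat); rewrite monE // aE.
Qed.

(** The monomials at distance t = 0, ..., L from the vertex s on its edge in
    direction i: they only involve x_i in the chart of s, where no generator
    becomes a power of x_i. *)
Lemma many_standard beta alpha0 L : ample beta -> ~ finite_support F gens ->
  exists alpha, nef (alpha - alpha0) /\ exists S : seq 'X_{1..r},
    [/\ uniq S, size S = L.+1 & forall a, a \in S -> standard gens alpha a].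
Proof.
move=> ampB notfin.
have [s [smax [i [si noG]]]] : exists s, s \in max_cones F /\
    exists i, i \in s /\ forall g, g \in gens ->
      exists2 j, j \in s & j != i /\ g j <> 0%N.
  apply: contrapT => none; apply: notfin => s smax i si.
  apply: contrapT => noG; apply: none; exists s; split=> //; exists i; split=> //.
  move=> g gG; apply: contrapT => nog; apply: noG; exists g => // j sj ji.
  by apply: contrapT => gj; apply: nog; exists j.
have [De _] := dualP smax; pose e := dual F s i.
(* Enough to exceed L steps along e plus the possibly negative coefficients of
   alpha0. *)
pose k := (\sum_p (L * `|pairing e (ray F p)| + `|local_divisor s alpha0 ord0 p|))%N.
pose alpha := alpha0 + beta *+ k; exists alpha.
split; first by rewrite addrC addKr; exact: ample_nef.
have loc_big p : p \notin s ->
    (L * `|pairing e (ray F p)|)%:Z <= local_divisor s alpha 0 p.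
  move=> sp; have nefA : nef (alpha - (alpha0 + beta *+ k)).
    by rewrite subrr -(mulr0n beta); exact: ample_nef.
  apply: le_trans (local_divisor_ample ampB smax nefA sp).
  have: (L * `|pairing e (ray F p)| + `|local_divisor s alpha0 ord0 p| <= k)%N.
    by rewrite /k (bigD1 p) //= leq_addr.
  move: (L * _)%N (local_divisor _ _ _ _) (k) => x y k'; clear; lia.
pose D t := local_divisor s alpha + div_char F (t%:Z *: e).
have DE t p : D t 0 p = local_divisor s alpha 0 p + t%:Z * pairing e (ray F p).
  by rewrite mxE div_charE pairingZl.
have D_on t p : p \in s -> D t 0 p = (t * (i == p))%:Z.
  by move=> sp; rewrite DE local_divisor_on // add0r De // PoszM; case: (i == p).
have D_ge0 t p : (t <= L)%N -> 0 <= D t 0 p.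
  move=> tL; have [sp|/loc_big] := boolP (p \in s); first by rewrite D_on.
  rewrite DE PoszM; move: (pairing _ _) (local_divisor _ _ _ _) => x y.
  rewrite abszE; nia.
exists [seq monomial_of (D t) | t <- iota 0 L.+1].
have monE t p : (t <= L)%N -> (monomial_of (D t) p)%:Z = D t 0 p.
  by move=> tL; rewrite monomial_ofE ?D_ge0.
split; last 1 first.
- move=> a /mapP[t]; rewrite mem_iota add0n ltnS => tL ->; split=> [|g gG].
    rewrite deg_monomial_of => [|p]; last exact: D_ge0.
    by rewrite -[RHS](cl_local_divisor s); apply/cl_eq; exists (t%:Z *: e).
  have [j sj [ji gj]] := noG g gG; exists j.
  rewrite -ltz_nat monE // D_on // eq_sym (negbTE ji) muln0 ltz_nat lt0n.
  exact/eqP.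
- rewrite map_inj_in_uniq ?iota_uniq // => t t'.
  rewrite !mem_iota !add0n !ltnS => /= tL t'L monEq.
  have := monE t i tL; rewrite monEq monE // !D_on // eqxx !muln1.
  by case.
- by rewrite size_map size_iota.
Qed.

End HilbertFunction.

(** * The Hilbert polynomial *)

Section HilbertPolynomial.
Variables (RR : realType) (n r : nat) (F : smooth_complete_fan RR n r).
Variable gens : seq 'X_{1..r}.
Variables (l : nat) (phi : {additive Cl F -> 'rV[int]_l}).
Hypothesis phi_bij : bijective phi.
Implicit Types (alpha beta : Cl F).

Lemma eval_classD P Q alpha :
  eval_class phi (P + Q) alpha = eval_class phi P alpha + eval_class phi Q alpha.
Proof. exact: mevalD. Qed.

Lemma eval_classC c alpha : eval_class phi c%:MP alpha = c.
Proof. exact: mevalC. Qed.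

Lemma linear_form_poly (L : Cl F -> int) :
  (forall alpha beta, L (alpha + beta) = L alpha + L beta) ->
  exists Q, forall alpha, eval_class phi Q alpha = (L alpha)%:~R.
Proof.
move=> LD; have [psi phiK psiK] := phi_bij.
have psiD u v : psi (u + v) = psi u + psi v.
  by apply: (can_inj phiK); rewrite raddfD !psiK.
pose f v := L (psi v).
have fB : zmod_morphism f.
  move=> u v; apply: (addIr (f v)).
  by rewrite /f -LD -psiD !subrK.
pose fA : {additive 'rV[int]_l -> int} :=
  HB.pack f (GRing.isZmodMorphism.Build _ _ f fB).
exists (\sum_k (f (delta_mx 0 k))%:~R *: 'X_k) => alpha.
rewrite /eval_class raddf_sum /= -[alpha in RHS]phiK.
have -> : L (psi (phi alpha)) = fA (phi alpha) by [].
rewrite [in RHS](row_sum_delta (phi alpha)) !raddf_sum /=.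
apply: eq_bigr => k _; rewrite mevalZ mevalXU.
rewrite -[X in X *: delta_mx _ _]intz scaler_int.
have -> z : f (delta_mx 0 k *~ z) = f (delta_mx 0 k) *~ z := raddfMz fA z _.
by rewrite -[X in _ = X%:~R]mulrzr intz intrM.
Qed.

(** It suffices to find, for each vertex s and ray i off s, a nef class whose
    coordinate (s, i) is positive, and to add these classes up.  If the
    coordinate L = (s, i) vanished on all nef classes, L - L(alpha0) would vanish
    wherever the values of P are prescribed, so P + L - L(alpha0) would compete
    with P; but L is not constant, as it takes the value 1 on the divisor D_i. *)
Lemma hilbert_polynomial_ample P : is_hilbert_polynomial gens phi P ->
  exists beta : Cl F, ample beta.
Proof.
move=> [[alpha0 P_hilb] P_uniq].
have pos s i : s \in max_cones F -> i \notin s ->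
    exists2 beta : Cl F, nef beta & 0 < local_divisor s beta 0 i.
  move=> smax si; apply: contrapT => none.
  pose L (alpha : Cl F) := local_divisor s alpha 0 i.
  have L_nef alpha : nef alpha -> L alpha = 0.
    move=> nefA; apply/eqP; rewrite eq_le (nefP _).1 // andbT leNgt.
    by apply/negP => pos; apply: none; exists alpha.
  have LD alpha beta : L (alpha + beta) = L alpha + L beta.
    by rewrite /L local_divisorD // mxE.
  have [Q QE] := linear_form_poly LD.
  have PQ : P = P + (Q + (- (L alpha0)%:~R)%:MP).
    apply: P_uniq; exists alpha0 => alpha nefA.
    have [d hd Pd] := P_hilb alpha nefA; exists d => //.
    rewrite !eval_classD eval_classC QE Pd -[alpha](subrK alpha0) LD L_nef //.
    by rewrite add0r subrr addr0.
  have QC : Q = (L alpha0)%:~R%:MP.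
    move: PQ; rewrite -[X in X = _]addr0 => /addrI/esym/eqP.
    by rewrite mpolyCN subr_eq0 => /eqP.
  have LC alpha : L alpha = L alpha0.
    by apply: (@intr_inj rat); rewrite -QE QC eval_classC.
  have := LC (cl F (delta_mx 0 i)); rewrite -(LC 0) (L_nef 0); last exact: nef0.
  rewrite /L -(@local_divisor_unique _ _ _ F s _ (delta_mx 0 i)) //.
    by rewrite mxE !eqxx.
  by move=> j sj; rewrite mxE eqxx /=; case: eqP => // ji; case/negP: si; rewrite -ji.
have /choice[b bP] : forall si : {set 'I_r} * 'I_r, exists beta : Cl F, nef beta /\
    (si.1 \in max_cones F -> si.2 \notin si.1 ->
       0 < local_divisor si.1 beta 0 si.2).
  case=> s i /=; have [smax|] := boolP (s \in max_cones F); last first.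
    by exists 0; split=> //; exact: nef0.
  have [si|si] := boolP (i \in s); last by have [beta] := pos s i smax si; exists beta.
  by exists 0; split=> //; exact: nef0.
exists (\sum_si b si) => s smax i si.
have -> : local_divisor s (\sum_si b si) 0 i =
          \sum_si local_divisor s (b si) 0 i.
  apply: (big_morph (fun beta : Cl F => local_divisor s beta 0 i)) => [x y|].
    by rewrite local_divisorD // mxE.
  by rewrite local_divisor0 // mxE.
rewrite (bigD1 (s, i)) //= ltr_pwDl //; first exact: (bP (s, i)).2.
by apply: sumr_ge0 => si' _; have [/nefP/(_ s smax i)] := bP si'.
Qed.

End HilbertPolynomial.

Theorem corollary4p4 (RR : realType) (n r : nat)
    (F : smooth_complete_fan RR n r) (gens : seq 'X_{1..r})
    (l : nat) (phi : {additive Cl F -> 'rV[int]_l}) (phi_bij : bijective phi)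
    (P : {mpoly rat[l]}) (hP : is_hilbert_polynomial gens phi P) :
  let klyachko_finite :=
    (forall i : 'I_r, min_deg gens i = 0%N) /\
    (forall s, s \in max_cones F -> finite_set (klyachko_Delta F gens s)) in
  (n <> 1%N -> ((exists c : rat, P = c%:MP) <-> klyachko_finite)) /\
  (klyachko_finite -> forall alpha : Cl F,
     eval_class phi P alpha =
       (\sum_(s in max_cones F) #|` fset_set (klyachko_Delta F gens s)|)%:R).
Proof.
move=> klyachko_finite.
have [beta ampB] := hilbert_polynomial_ample phi_bij hP.
have [[alpha0 P_hilb] P_uniq] := hP.
set N := (\sum_(s in max_cones F) _)%N.
have PN : klyachko_finite -> P = (N%:R)%:MP.
  move=> [s0 finD].
  have [alpha1 NP] := hilbert_function_Delta ampB s0 (Delta_finite_support s0 finD).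
  apply: P_uniq; exists alpha1 => alpha /NP hN.
  by exists N; rewrite ?eval_classC.
split=> [n1|kfin alpha]; last by rewrite PN // eval_classC.
split=> [[c Pc]|/PN ->]; last by exists N%:R.
suff finG : finite_support F gens.
  split; first exact: finite_support_min_deg n1 finG.
  by move=> s smax; apply: finite_support_Delta.
apply: contrapT => notfin.
have [|d hd cd] := P_hilb alpha0.
  by rewrite subrr -(mulr0n beta); exact: ample_nef.
have [alpha [nefA [S [uS sS SE]]]] := many_standard alpha0 d ampB notfin.
have [d' hd' cd'] := P_hilb alpha nefA.
have dd : d' = d.
  by apply/eqP; rewrite -(eqr_nat rat) -cd -cd' Pc !eval_classC.
by have := hilbert_function_bound uS SE hd'; rewrite sS dd ltnn.
Qed.
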